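(* Let $W$ be a binary erasure channel with erasure probability $z\in[0,1]$. For $\varepsilon\in(0,1)$ such that $n:=-5\log_2\varepsilon$ is a positive integer, let $\mathcal T=\mathcal T(W,\varepsilon)$ be the channel tree generated from the root $W$ by the rule: apply the channel transformation $T$ to a vertex $w$ (i.e. give $w$ the two children $w^\flat$ and $w^\sharp$) if and only if $\operatorname{depth}(w)<n$ and $Y(w)>\varepsilon 2^{-n}$. Let $N=2^{\operatorname{depth}(\mathcal T)}$. Then the number of magic devices used in the circuit generated by $\mathcal T$ is $O(N\log|\log\varepsilon|)$ as $\varepsilon\to0$; that is, there are constants $C>0$ and $\varepsilon_0\in(0,1)$ (which may depend on $W$) such that for all $\varepsilon\in(0,\varepsilon_0)$ with $-5\log_2\varepsilon$ an integer, this number is at most $C\,N\log|\log\varepsilon|$.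
   Context: For a binary erasure channel $w$, let $Z(w)\in[0,1]$ denote its erasure probability (its Bhattacharyya parameter) and $Y(w)=\min\{Z(w),1-Z(w)\}$. The channel transformation $T$ turns two independent copies of $w$ into one copy of $w^\flat$ and one copy of $w^\sharp$, which are binary erasure channels with $Z(w^\flat)=1-(1-Z(w))^2$ and $Z(w^\sharp)=Z(w)^2$. A channel tree is a finite rooted full binary tree (each vertex has zero or two children) whose vertices are labelled by channels, such that the children of every non-leaf vertex $w$ are $w^\flat$ and $w^\sharp$. The root has depth $0$; $\operatorname{depth}(w)$ is the distance of $w$ from the root; the depth of a tree is the depth of its deepest leaf. Different vertices are regarded as distinct even if their labels have equal erasure probabilities. A channel tree $\mathcal T$ with root $W$ generates a circuit consuming $N=2^{\operatorname{depth}(\mathcal T)}$ copies of $W$. At a vertex $w$ there are $2^{\operatorname{depth}(\mathcal T)-\operatorname{depth}(w)}$ copies of the channel $w$; if $w$ is not a leaf, these copies are grouped into pairs, and each pair is transformed into a $w^\flat$ and a $w^\sharp$ by means of two magic devices (one encoding device and one decoding device). Hence the number of magic devices in the circuit is $\sum_{w\text{ non-leaf}}2^{\operatorname{depth}(\mathcal T)-\operatorname{depth}(w)}$, which equals $N\,\mathbb E[\tau]$, where $\tau$ is the depth of the random leaf reached by starting at the root and repeatedly moving to one of the two children with probability $1/2$ each until a leaf is reached. *)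

(* Defs.v *)
From HB Require Import structures.
From mathcomp Require Import all_boot all_order all_algebra.
From mathcomp Require Import reals exp lra.

Set Implicit Arguments.
Unset Strict Implicit.
Unset Printing Implicit Defensive.

Import Order.TTheory GRing.Theory Num.Theory.
Local Open Scope ring_scope.

(* A binary erasure channel, encoded by its erasure probability. *)
Record bec (R : realType) := Bec { Z : R; Z01 : 0 <= Z <= 1 }.

Definition Y (R : realType) (w : bec R) : R := Num.min (Z w) (1 - Z w).

Fact flat_subproof (R : realType) (w : bec R) : 0 <= 1 - (1 - Z w) ^+ 2 <= 1.
Proof. by case: w => z /= /andP[z0 z1]; apply/andP; split; nra. Qed.

Fact sharp_subproof (R : realType) (w : bec R) : 0 <= Z w ^+ 2 <= 1.
Proof. by case: w => z /= /andP[z0 z1]; apply/andP; split; nra. Qed.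

Definition flat (R : realType) (w : bec R) : bec R := Bec (flat_subproof w).
Definition sharp (R : realType) (w : bec R) : bec R := Bec (sharp_subproof w).

Inductive tree (R : realType) :=
  | Leaf of bec R
  | Node of bec R & tree R & tree R.

Fixpoint depth (R : realType) (t : tree R) : nat :=
  match t with
  | Leaf _ => 0%N
  | Node _ l r => (maxn (depth l) (depth r)).+1
  end.

(* The multiset of depths of the non-leaf vertices of [t], when the root of [t]
   is at depth [d]. *)
Fixpoint inner_depths (R : realType) (d : nat) (t : tree R) : seq nat :=
  match t with
  | Leaf _ => [::]
  | Node _ l r => d :: inner_depths d.+1 l ++ inner_depths d.+1 r
  end.

(* The 2 ^ (depth t - d) copies of a non-leaf channel at depth d form
   2 ^ (depth t - d) / 2 pairs, each using one encoding and one decoding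
   device. *)
Definition magic_devices (R : realType) (t : tree R) : nat :=
  (\sum_(d <- inner_depths 0 t) 2 ^ (depth t - d))%N.

(* [rule d w] tells whether T is to be applied to a vertex labelled [w] at
   depth [d]. [is_generated rule d w t] says that [t], whose root sits at depth
   [d], is the channel tree with root [w] obtained by applying T exactly where
   [rule] demands it. *)
Fixpoint is_generated (R : realType) (rule : nat -> bec R -> bool)
    (d : nat) (w : bec R) (t : tree R) : Prop :=
  match t with
  | Leaf v => v = w /\ ~~ rule d w
  | Node v l r => [/\ v = w, rule d w,
      is_generated rule d.+1 (flat w) l & is_generated rule d.+1 (sharp w) r]
  end.

(* [k] bounds the number of further levels; see [growP]. *)
Fixpoint grow (R : realType) (rule : nat -> bec R -> bool)
    (k d : nat) (w : bec R) : tree R :=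
  if k is k'.+1 then
    if rule d w then
      Node w (grow rule k' d.+1 (flat w)) (grow rule k' d.+1 (sharp w))
    else Leaf w
  else Leaf w.

Definition split_rule (R : realType) (eps : R) (n d : nat) (w : bec R) : bool :=
  (d < n)%N && (Y w > eps * 2 ^- n).

Definition channel_tree (R : realType) (W : bec R) (eps : R) (n : nat) : tree R :=
  grow (split_rule eps n) n 0 W.

Lemma growP (R : realType) (rule : nat -> bec R -> bool) (k d : nat)
    (w : bec R) (t : tree R) :
  (forall d' v, rule d' v -> (d' < d + k)%N) ->
  is_generated rule d w t <-> t = grow rule k d w.
Proof.
elim: k d w t => [|k IHk] d w t rule_lt /=.
  have Nr v : rule d v = false.
    by apply/negP => /rule_lt; rewrite addn0 ltnn.
  case: t => [v|v l r] /=; rewrite Nr; split => //; first by case=> ->.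
  - by case=> ->.
  - by case.
have lt' d' v : rule d' v -> (d' < d.+1 + k)%N.
  by move/rule_lt; rewrite addnS addSn.
case: t => [v|v l r] /=; case: (rule d w); split => //.
- by case.
- by case=> ->.
- by case=> ->.
- by case=> -> _ /(IHk _ _ _ lt') -> /(IHk _ _ _ lt') ->.
- by case=> -> -> ->; split=> //; apply/(IHk _ _ _ lt').
- by case.
Qed.

Corollary channel_treeP (R : realType) (W : bec R) (eps : R) (n : nat)
    (t : tree R) :
  is_generated (split_rule eps n) 0 W t <-> t = channel_tree W eps n.
Proof. by apply: growP => d v /andP[]. Qed.

(* Main.v *)
(* The potential [ln (L z)] with [L z = - ln (z (1 - z))] drifts upwards along
   the random walk from the root: at small z one child roughly doubles L while
   the other lowers it by at most ln 2, and in fact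
   [L (z^2) * L (1 - (1 - z)^2) >= 21/20 * L z ^ 2] on the whole of (0, 1), so
   each step raises the potential by at least [ln (21/20) / 2] on average.
   A vertex is split only if [L <= ln 2 + 6 |ln eps|], and a step at most
   doubles L, so the potential never exceeds [ln (14 |ln eps|)].  Hence the
   expected number of steps is O(ln |ln eps|). *)
Require Import Defs.
From mathcomp Require Import all_boot all_order all_algebra.
From mathcomp Require Import reals sequences exp.
From mathcomp Require Import ring lra.

Set Implicit Arguments.
Unset Strict Implicit.
Unset Printing Implicit Defensive.

Import Order.TTheory GRing.Theory Num.Theory.
Local Open Scope ring_scope.

Lemma ln_le_subr1 (R : realType) (x : R) : 0 < x -> ln x <= x - 1.
Proof.
move=> x0; have := @le_ln1Dx R (x - 1).
by rewrite [1 + _]addrC subrK; apply; lra.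
Qed.

(** On (0, 1) this is within [ln 2] of minus the logarithm of [min z (1 - z)], but as a sum of
    logarithms it changes by explicit terms under both transforms. *)
Definition logY (R : realType) (z : R) : R := - ln (z * (1 - z)).

Lemma logYC (R : realType) (z : R) : logY (1 - z) = logY z.
Proof. by rewrite /logY subKr mulrC. Qed.

Lemma logYE (R : realType) (z : R) :
  0 < z < 1 -> logY z = - (ln z + ln (1 - z)).
Proof. by move=> /andP[z0 z1]; rewrite /logY lnM// posrE; lra. Qed.

Lemma logY_sqr (R : realType) (z : R) :
  0 < z < 1 -> logY (z ^+ 2) = - (ln z *+ 2 + ln (1 - z) + ln (1 + z)).
Proof.
move=> /andP[z0 z1]; rewrite logYE; last by apply/andP; split; nra.
have -> : 1 - z ^+ 2 = (1 - z) * (1 + z) by ring.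
by rewrite lnXn// lnM ?posrE ?addrA//; lra.
Qed.

Lemma logY_flat (R : realType) (z : R) : 0 < z < 1 ->
  logY (1 - (1 - z) ^+ 2) = - (ln z + ln (1 - z) *+ 2 + ln (2 - z)).
Proof.
move=> /andP[z0 z1]; rewrite logYC logY_sqr; last by apply/andP; split; lra.
have -> : 1 - (1 - z) = z by ring.
have -> : 1 + (1 - z) = 2 - z by ring.
by rewrite [ln z + _]addrC.
Qed.

(** The product [z * (1 - z)] is at most 1/4, whose logarithm is at most 2 * (1/2 - 1) = -1. This
    makes the potential [ln (logY z)] nonnegative. *)
Lemma logY_ge1 (R : realType) (z : R) : 0 < z < 1 -> 1 <= logY z.
Proof.
move=> /andP[z0 z1]; rewrite /logY lerNr.
have h : ln (z * (1 - z)) <= ln (2^-1 ^+ 2 : R).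
  rewrite ler_ln ?posrE ?exprn_gt0 ?invr_gt0//; last by apply: mulr_gt0; lra.
  have := sqr_ge0 (z - 2^-1); rewrite !expr2; lra.
apply: le_trans h _; rewrite lnXn; last lra.
have : ln (2^-1 : R) <= 2^-1 - 1 by apply: ln_le_subr1; lra.
lra.
Qed.

(** Up to 2/5 the factors are bounded separately, by 7/5 and 3/4 times [logY z], and 7/5 * 3/4 =
    21/20. Closer to 1/2 they have to be treated jointly. *)
Lemma logY_sqr_flat_le_half (R : realType) (z : R) : 0 < z <= 2^-1 ->
  21 / 20 * logY z ^+ 2 <= logY (z ^+ 2) * logY (1 - (1 - z) ^+ 2).
Proof.
move=> /andP[z0 zh].
have z01 : 0 < z < 1 by apply/andP; split; lra.
have L1 := logY_ge1 z01.
rewrite logY_sqr// logY_flat//.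
rewrite logYE// in L1 *.
set p := ln z in L1 *; set q := ln (1 - z) in L1 *.
set r := ln (1 + z); set s := ln (2 - z).
have [zs|zs] := lerP z (2 / 5).
- have pr : 3 * p + 5 * r <= 2 * q.
    have : ln (z ^+ 3 * (1 + z) ^+ 5) <= ln ((1 - z) ^+ 2).
      rewrite ler_ln ?posrE; last 2 first.
      + by apply: mulr_gt0; apply: exprn_gt0; lra.
      + by apply: exprn_gt0; lra.
      (* The left side increases with [z] and the right side decreases, so the endpoint 2/5 is the
         worst case. *)
      apply: (@le_trans _ _ ((2 / 5) ^+ 3 * (1 + 2 / 5) ^+ 5)).
        apply: ler_pM; rewrite ?exprn_ge0 ?lerXn2r ?nnegrE//; lra.
      apply: (@le_trans _ _ ((1 - 2 / 5) ^+ 2)); first by lra.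
      by rewrite lerXn2r ?nnegrE; lra.
    rewrite lnM ?posrE ?exprn_gt0 ?lnXn//; [|lra..].
    rewrite -/p -/q -/r; lra.
  (* [ln x <= x - 1] at [x = 3/5 * (1-z)(2-z)] and [x = (5/3)^4 * z(1-z)]; the
     scaling is chosen so that both are close to 1 at the worst z (about 1/8) *)
  have qs : 4 * (q + s) + (p + q) <= 0.
    have u0 : 0 < (1 - z) * (2 - z) by nra.
    have h0 : 0 < z * (1 - z) by nra.
    have c0 : 0 < 3 / 5 :> R by lra.
    have := @ln_le_subr1 R (3 / 5 * ((1 - z) * (2 - z))) (mulr_gt0 c0 u0).
    have c'0 : 0 < (5 / 3) ^+ 4 :> R by apply: exprn_gt0; lra.
    have := @ln_le_subr1 R ((5 / 3) ^+ 4 * (z * (1 - z))) (mulr_gt0 c'0 h0).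
    have c'E : ln ((5 / 3) ^+ 4 : R) = - ln (3 / 5) *+ 4.
      by rewrite lnXn ?divr_gt0// -lnV ?posrE//; congr (ln _ *+ _); field.
    rewrite [ln (_ ^+ 4 * _)]lnM ?posrE// [ln (z * _)]lnM ?posrE; [|lra..].
    rewrite [ln (3 / 5 * _)]lnM ?posrE// [ln ((1 - z) * _)]lnM ?posrE; [|lra..].
    rewrite c'E -/p -/q -/s => h1 h2.
    nra.
  have a : 7 / 5 * - (p + q) <= - (p *+ 2 + q + r) by lra.
  have b : 3 / 4 * - (p + q) <= - (p + q *+ 2 + s) by lra.
  apply: le_trans (ler_pM _ _ a b); nra.
(* With [L = - (p + q)] the product is [(L + a) * (L + b)], where [a = - (p + r)] and
   [b = - (q + s)] are nonnegative. The bound [rs] says [a + b >= L / 4], so the product is at least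
   [5 / 4 * L ^ 2]. *)
- have pr : p + r <= 0.
    rewrite -lnM ?posrE; [|lra..].
    apply: ln_le0; nra.
  have qs : q + s <= 0.
    rewrite -lnM ?posrE; [|lra..].
    apply: ln_le0; nra.
  have rs : 4 * (r + s) + 3 * (p + q) <= 0.
    have : ln (((1 + z) * (2 - z)) ^+ 4 * (z * (1 - z)) ^+ 3) <= 0.
      apply: ln_le0.
      apply: (@le_trans _ _ ((9 / 4) ^+ 4 * (1 / 4) ^+ 3)); last by lra.
      have u0 : 0 <= (1 + z) * (2 - z) by nra.
      have h0 : 0 <= z * (1 - z) by nra.
      apply: ler_pM; rewrite ?exprn_ge0 ?lerXn2r ?nnegrE//; nra.
    have u0 : 0 < (1 + z) * (2 - z) by nra.
    have h0 : 0 < z * (1 - z) by nra.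
    rewrite lnM ?posrE ?exprn_gt0// !lnXn// !lnM ?posrE; [|lra..].
    rewrite -/p -/q -/r -/s; lra.
  nra.
Qed.

(** The reflection of [z] to [1 - z] preserves [logY] and swaps the two factors. *)
Lemma logY_sqr_flat (R : realType) (z : R) : 0 < z < 1 ->
  21 / 20 * logY z ^+ 2 <= logY (z ^+ 2) * logY (1 - (1 - z) ^+ 2).
Proof.
move=> /andP[z0 z1]; have [zh|zh] := lerP z 2^-1.
  by apply: logY_sqr_flat_le_half; rewrite z0.
have : 0 < 1 - z <= 2^-1 by apply/andP; split; lra.
by move/logY_sqr_flat_le_half; rewrite subKr !logYC [leRHS]mulrC.
Qed.

Lemma logY_sqr_le (R : realType) (z : R) :
  0 < z < 1 -> logY (z ^+ 2) <= 2 * logY z.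
Proof.
move=> z01; rewrite logY_sqr// logYE//; case/andP: z01 => z0 z1.
have : ln (1 - z) <= ln (1 + z) by rewrite ler_ln ?posrE; lra.
have : 0 <= ln (1 + z) by apply: ln_ge0; lra.
have : ln (1 - z) <= 0 by apply: ln_le0; lra.
lra.
Qed.

Lemma logY_flat_le (R : realType) (z : R) :
  0 < z < 1 -> logY (1 - (1 - z) ^+ 2) <= 2 * logY z.
Proof.
move=> /andP[z0 z1]; rewrite logYC -(logYC z).
by apply: logY_sqr_le; apply/andP; split; lra.
Qed.

(** Each pair of copies pays for its two devices out of the room left below [ln (2 * B)], which the
    drift shrinks. [D] stays fixed in the induction because subtrees are weighted by the depth of
    the whole tree, not by their own. *)
Lemma grow_devices_le (R : realType) (rule : nat -> bec R -> bool) (B : R) :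
  (forall d w, rule d w -> 0 < Z w < 1 /\ logY (Z w) <= B) ->
  forall (k d D : nat) (w : bec R),
    ln (logY (Z w)) <= ln (2 * B) ->
    (d + depth (grow rule k d w) <= D)%N ->
    ln (21 / 20) / 2 *
      (\sum_(i <- inner_depths d (grow rule k d w)) 2 ^ (D - i))%N%:R
    <= 2 ^+ (D - d) * (ln (2 * B) - ln (logY (Z w))).
Proof.
move=> ruleP; elim=> [|k IHk] d D w wB /=.
  by move=> _; rewrite big_nil mulr0 mulr_ge0 ?exprn_ge0// subr_ge0.
case: ifPn => [/ruleP[z01 zB]|_] /=; last first.
  by move=> _; rewrite big_nil mulr0 mulr_ge0 ?exprn_ge0// subr_ge0.
rewrite addnS -addSn => dD.
have z01' : 0 < 1 - Z w < 1 by case/andP: z01 => *; apply/andP; split; lra.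
have sq01 (z : R) : 0 < z < 1 -> 0 < z ^+ 2 < 1.
  by case/andP=> *; apply/andP; split; nra.
have Lw := logY_ge1 z01.
have Ls : 1 <= logY (Z (sharp w)) by apply/logY_ge1/sq01.
have Lf : 1 <= logY (Z (flat w)) by rewrite /= logYC; apply/logY_ge1/sq01.
have drift : ln (21 / 20) + 2 * ln (logY (Z w))
    <= ln (logY (Z (flat w))) + ln (logY (Z (sharp w))).
  have := logY_sqr_flat z01.
  rewrite -ler_ln ?posrE; first last.
  - by apply: mulr_gt0; apply: lt_le_trans ltr01 _.
  - by rewrite mulr_gt0 ?exprn_gt0//; lra.
  rewrite [ln (21 / 20 * _)]lnM ?posrE ?exprn_gt0//; [|lra..].
  rewrite lnXn ?lnM ?posrE; [|lra..].
  by rewrite mulr_natl [leRHS]addrC.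
have childB v : 1 <= logY (Z v) -> logY (Z v) <= 2 * logY (Z w) ->
    ln (logY (Z v)) <= ln (2 * B).
  by move=> v1 vw; rewrite ler_ln ?posrE; lra.
have [fD sD] : (d.+1 + depth (grow rule k d.+1 (flat w)) <= D)%N /\
               (d.+1 + depth (grow rule k d.+1 (sharp w)) <= D)%N.
  by split; apply: leq_trans dD; rewrite leq_add2l ?leq_maxl ?leq_maxr.
(* Strictness matters: with truncated subtraction, [2 ^ (D - d)] is twice [2 ^ (D - d.+1)] only if
   [d < D]. *)
have dltD : (d < D)%N by apply: leq_trans fD; apply: leq_addr.
have IHf := IHk _ _ _ (childB _ Lf (logY_flat_le z01)) fD.
have IHs := IHk _ _ _ (childB _ Ls (logY_sqr_le z01)) sD.
rewrite big_cons big_cat /= !natrD natrX.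
move: IHf IHs; rewrite -(subSS d D) subSn// exprS.
set P := 2 ^+ _; set G := ln (2 * B).
have P0 : 0 <= P :> R by apply: exprn_ge0.
nra.
Qed.

(** One of [Z w] and [1 - Z w] is at least 1/2 and the other exceeds [t], so their product exceeds
    [t / 2]. *)
Lemma logY_le_Y (R : realType) (w : bec R) (t : R) :
  0 < t < Y w -> 0 < Z w < 1 /\ logY (Z w) <= ln 2 - ln t.
Proof.
rewrite /Y lt_min => /and3P[t0 tz tz'].
have z01 : 0 < Z w < 1 by apply/andP; split; lra.
split=> //; rewrite /logY lerNl opprB -ln_div ?posrE// ler_ln ?posrE.
- have [zh|zh] := lerP (Z w) 2^-1; nra.
- by rewrite divr_gt0.
- by apply: mulr_gt0; lra.
Qed.

Theorem theorem4 (R : realType) (W : bec R) :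
  exists C eps0 : R,
    [/\ 0 < C, 0 < eps0 < 1 &
      forall (eps : R) (n : nat),
        0 < eps < eps0 ->
        (0 < n)%N ->
        n%:R = - 5 * (ln eps / ln 2) ->
        let t := channel_tree W eps n in
        let N := (2 ^ depth t)%N in
        (magic_devices t)%:R <= C * N%:R * ln `|ln eps|].
Proof.
have k0 : 0 < ln (21 / 20) :> R by apply: ln_gt0; lra.
(* Below [expR (- 14)], [E = - ln eps] exceeds 14, so [ln (14 * E) <= 2 * ln E]; dividing by the
   drift [ln (21 / 20) / 2] gives the constant 4. *)
exists (4 / ln (21 / 20)), (expR (- 14)); split.
- by rewrite divr_gt0.
- by rewrite expR_gt0 -[ltRHS]expR0 ltr_expR; lra.
move=> eps n /andP[e0 e14] n0 nE; cbv zeta; set t := channel_tree W eps n.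
have lne : ln eps < - 14 by rewrite -[ltRHS]expRK ltr_ln ?posrE ?expR_gt0.
have Eabs : `|ln eps| = - ln eps by rewrite ltr0_norm//; lra.
rewrite {}Eabs; set E := - ln eps.
have E14 : 14 < E by rewrite /E; lra.
have ln2_le1 : ln 2 <= 1 :> R by have := @ln_le_subr1 R 2 ltac:(lra); lra.
have ln2_gt0 : 0 < ln 2 :> R by apply: ln_gt0; lra.
(* The choice of [n] makes [2 ^- n] equal to [eps ^+ 5], so the threshold is [eps ^+ 6]. *)
have lnthr : ln (eps * 2 ^- n) = - (6 * E).
  rewrite lnM ?posrE ?invr_gt0 ?exprn_gt0// lnV ?posrE ?exprn_gt0//.
  by rewrite lnXn// -[ln 2 *+ n]mulr_natr nE /E; field; rewrite gt_eqF.
have thr0 : 0 < eps * 2 ^- n by rewrite divr_gt0// exprn_gt0.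
have ruleP d w : split_rule eps n d w -> 0 < Z w < 1 /\ logY (Z w) <= 7 * E.
  case/andP=> _ thr; have [|z01 L] := @logY_le_Y _ w (eps * 2 ^- n).
    by rewrite thr0.
  by split=> //; rewrite lnthr in L; lra.
have lnE : 0 < ln E by apply: ln_gt0; lra.
(* An unsplit root may be perfect, useless or beyond the potential bound, but then the tree is a
   single leaf without devices. *)
have [W0|W0] := boolP (split_rule eps n 0 W); last first.
  have tE : t = Leaf W.
    by rewrite /t /channel_tree; case: (n) W0 => //= m /negbTE ->.
  by rewrite tE /magic_devices big_nil !mulr_ge0 ?invr_ge0// ltW.
have [W01 WB] := ruleP _ _ W0.
have LW := logY_ge1 W01.
have WG : ln (logY (Z W)) <= ln (2 * (7 * E)) by rewrite ler_ln ?posrE; lra.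
have := @grow_devices_le R _ _ ruleP n 0 (depth t) W WG (leqnn _).
rewrite subn0 -/(magic_devices t) -natrX => bound.
have lnLW : 0 <= ln (logY (Z W)) by apply: ln_ge0.
have GE : ln (2 * (7 * E)) <= 2 * ln E.
  have -> : 2 * ln E = ln (E * E) by rewrite lnM ?posrE; lra.
  by rewrite ler_ln ?posrE; nra.
set M := (magic_devices t)%:R in bound *.
set N := (2 ^ depth t)%:R in bound *.
have N0 : 0 <= N by apply: ler0n.
rewrite -mulrA -mulrAC ler_pdivlMr//.
nra.
Qed.
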